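(* Let $\sigma$ be a surjective endomorphism of $(X,\mathcal B,\mu)$, where $\mu$ is a $\sigma$-invariant probability measure. Then the operators $R_\sigma$ and $S_\sigma^*$ coincide on $L^2(\mu)$, where $R_\sigma(f)(x)=\int_{C_x}f(y)\,d\mu_{C_x}(y)$ with $C_x=\sigma^{-1}(x)$, and $S_\sigma^*$ is the adjoint of the composition operator $S_\sigma(f)=f\circ\sigma$ on $L^2(\mu)$.
   Context: $(X,\mathcal B)$ is a standard Borel space, $\mu$ a non-atomic Borel probability measure, $\sigma:X\to X$ a measurable surjection; $\sigma$-invariant means $\mu(\sigma^{-1}(A))=\mu(A)$ for $A\in\mathcal B$. Equalities of functions are modulo $\mu$-null sets. The partition of $X$ into the sets $C_x=\sigma^{-1}(x)$, $x\in X$, is measurable, and $(\mu_{C_x})$ denotes the (essentially unique) system of conditional probability measures for it: $\mu_{C_x}$ is a Borel probability measure carried by $C_x$, $x\mapsto\mu_{C_x}(B\cap C_x)$ is measurable for each $B\in\mathcal B$, and, identifying the quotient space with $X$ via $C_x\leftrightarrow x$ so that the quotient measure is $\mu\circ\sigma^{-1}=\mu$, one has $\int_X f\,d\mu=\int_X\left(\int_{C_x}f(y)\,d\mu_{C_x}(y)\right)d\mu(x)$ for $f\in L^1(\mu)$. *)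

(* Defs.v *)
From HB Require Import structures.
From mathcomp Require Import all_boot all_order all_algebra.
From mathcomp Require Import all_classical all_reals all_analysis.
From mathcomp Require Import measurable_realfun.

Set Implicit Arguments.
Unset Strict Implicit.
Unset Printing Implicit Defensive.
Import Order.TTheory GRing.Theory Num.Theory.
Import numFieldNormedType.Exports.

Local Open Scope classical_set_scope.
Local Open Scope ring_scope.

(* [phi] is a Borel isomorphism of [X] onto a Polish space [P]; the Hausdorff
   axiom makes the complete pseudometric of [P] a metric. *)
Definition standard_borel (R : realType) (d : measure_display)
    (X : measurableType d) : Prop :=
  exists (P : completePseudoMetricType R) (phi : X -> P),
    [/\ hausdorff_space P,
        @second_countable P,
        bijective phi &
        forall B : set P, measurable (phi @^-1` B) <-> <<s open >> B].

Section Endomorphism.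
Context (R : realType) (d : measure_display) (X : measurableType d).
Implicit Types (mu : probability X R) (sigma : X -> X)
  (nu : X -> probability X R) (A B : (X -> R) -> X -> R).

Definition nonatomic mu : Prop :=
  forall A : set X, measurable A -> (0 < mu A)%E ->
    exists B : set X,
      [/\ measurable B, B `<=` A, (0 < mu B)%E & (mu B < mu A)%E].

Definition surjective_endomorphism sigma : Prop :=
  measurable_fun setT sigma /\ set_surj setT setT sigma.

Definition invariant_measure mu sigma : Prop :=
  forall A : set X, measurable A -> mu (sigma @^-1` A) = mu A.

Definition fiber sigma (x : X) : set X := sigma @^-1` [set x].

(* [nu x] is the conditional measure on [fiber sigma x].  Such a system is only
   determined up to a null set of points [x], and a system carried by every
   single fiber need not exist (it would force [sigma] to have a Borel
   section), hence the almost everywhere quantifier.  The outer integral is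
   against [mu] because the quotient measure [mu \o sigma^-1] is [mu]. *)
Definition conditional_measures mu sigma nu : Prop :=
  [/\ {ae mu, forall x, nu x (fiber sigma x) = 1%E},
      (forall B : set X, measurable B ->
         measurable_fun setT (fun x => nu x (B `&` fiber sigma x))) &
      (forall f : X -> R, f \in Lfun mu 1%E ->
         (\int[mu]_x (f x)%:E =
          \int[mu]_x \int[nu x]_(y in fiber sigma x) (f y)%:E)%E)].

Definition composition_op sigma (f : X -> R) : X -> R := f \o sigma.

Definition conditional_op sigma nu (f : X -> R) : X -> R :=
  fun x => \int[nu x]_(y in fiber sigma x) f y.

(* Elements of L^2(mu) are handled through representatives [f \in Lfun mu 2],
   equality being equality [mu]-almost everywhere; linearity and boundedness
   make a [bounded_L2_operator] compatible with that equality. *)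
Definition L2dot mu (f g : X -> R) : R := \int[mu]_x (f x * g x).

Definition bounded_L2_operator mu A : Prop :=
  [/\ (forall f : X -> R, f \in Lfun mu 2%:E -> A f \in Lfun mu 2%:E),
      (forall (a : R) (f g : X -> R), f \in Lfun mu 2%:E -> g \in Lfun mu 2%:E ->
         {ae mu, forall x, A (fun y => a * f y + g y) x = a * A f x + A g x}) &
      (exists C : R, forall f : X -> R, f \in Lfun mu 2%:E ->
         ('N[mu]_2%:E[EFin \o A f] <= C%:E * 'N[mu]_2%:E[EFin \o f])%E)].

Definition is_L2_adjoint mu A B : Prop :=
  [/\ bounded_L2_operator mu A, bounded_L2_operator mu B &
      forall f g : X -> R, f \in Lfun mu 2%:E -> g \in Lfun mu 2%:E ->
        L2dot mu (A f) g = L2dot mu f (B g)].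

End Endomorphism.

(* Main.v *)
Require Import Defs.
From HB Require Import structures.
From mathcomp Require Import all_boot all_order all_algebra.
From mathcomp Require Import all_classical all_reals all_analysis.
From mathcomp Require Import measurable_realfun lra.
Import Order.TTheory GRing.Theory Num.Theory.
Import numFieldNormedType.Exports.
Local Open Scope classical_set_scope.
Local Open Scope ring_scope.
Set Implicit Arguments.
Unset Strict Implicit.
Unset Printing Implicit Defensive.

(** Write [R f x] for the integral of [f] against [nu x] over the fiber of [x]
    and [S f] for [f \o sigma].  The identity
      int (S f) g dmu = int_x int_(fiber x) f (sigma y) g y dnu_x(y) dmu(x)
                      = int_x f x (R g x) dmu(x)
    is the whole point: disintegrate the integrable function [(S f) g], then
    use that [f \o sigma] is constantly [f x] on the fiber of [x], so that it
    leaves the inner integral ([L2dot_composition]).  Since an adjoint is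
    unique up to null sets ([is_L2_adjoint_unique]), every adjoint of [S]
    agrees with [R] almost everywhere.

    The remaining work is to see that [S] and [R] are bounded operators on L^2.
    For [S], invariance makes it an isometry.  For [R], Jensen's inequality on
    each fiber ([sqr_Rintegral_le]) bounds [(R f x)^2] by the fiber integral of
    [f^2], whose integral over [x] is that of [f^2] ([Lnorm2_conditional]).
    Measurability of [R f] comes from viewing [x |-> nu x (_ `&` fiber x)] as a
    transition kernel ([measurable_fiber_integral]); this is where the
    standard Borel hypothesis enters, as it makes the fibers measurable.
    Linearity of [R] is obtained almost everywhere, at those [x] for which
    the functions involved are [nu x]-integrable on the fiber
    ([ae_fiber_integrable]). *)

(** * Measurability of the fibers *)

(** The Borel isomorphism reduces this to points of a Hausdorff space being
    closed. *)
Lemma measurable_set1_standard_borel (R : realType) (d : measure_display)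
    (X : measurableType d) (x : X) :
  standard_borel R X -> measurable [set x].
Proof.
move=> [P [phi [hP _ bphi hB]]].
have -> : [set x] = phi @^-1` [set phi x].
  by apply/seteqP; split => [y ->//|y /= /(bij_inj bphi)].
apply/hB; rewrite -[X in <<s _ >> X]setCK -setTD.
apply: sigma_algebraCD; apply: sub_sigma_algebra.
apply: closed_openC; apply: accessible_closed_set1.
exact: hausdorff_accessible.
Qed.

Lemma measurable_fiber (R : realType) (d : measure_display)
    (X : measurableType d) (sigma : X -> X) (x : X) :
  standard_borel R X -> measurable_fun setT sigma ->
  measurable (fiber sigma x).
Proof.
move=> hX msigma; rewrite -[fiber _ _]setTI.
apply: msigma => //; exact: (measurable_set1_standard_borel _ hX).
Qed.

(** * Integration over a subset *)

Section restriction.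
Context d (T : measurableType d) (R : realType).
Variables (m : {measure set T -> \bar R}) (D : set T) (mD : measurable D).
Local Open Scope ereal_scope.

(** Turns integration over a moving domain, such as the fiber of [x], into
    integration over the whole space against a moving measure, the form that
    measurability of kernel integrals requires. *)
Lemma ge0_integral_mrestr (f : T -> \bar R) :
  measurable_fun setT f -> (forall x, 0 <= f x) ->
  \int[mrestr m mD]_x f x = \int[m]_(x in D) f x.
Proof.
move=> mf f0.
have mDC : measurable (~` D) by exact: measurableC.
rewrite (@ge0_negligible_integral _ _ _ (mrestr m mD) setT (~` D))//; last first.
  by rewrite /= /mrestr setICl measure0.
rewrite setTD setCK; apply: eq_measure_integral => A mA AD.
by rewrite /= /mrestr setIidl.
Qed.

(** Jensen's inequality for the square: with [a] the integral of [f], integrate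
    the tangent line bound [2 a f - a^2 <= f^2] and use that the total mass is
    at most 1.  When [f^2] is not integrable the right-hand side is infinite,
    so the inequality holds whatever value the left-hand integral takes. *)
Lemma sqr_Rintegral_le (f : T -> R) :
  measurable_fun setT f -> m D <= 1 ->
  ((\int[m]_(x in D) f x) ^+ 2)%:E <= \int[m]_(x in D) (f x ^+ 2)%:E.
Proof.
move=> mf mD1.
have mfD : measurable_fun D f by exact: measurable_funTS.
have mf2 : measurable_fun D (EFin \o (fun x => f x ^+ 2)%R).
  by apply/measurable_EFinP; exact: measurable_funX.
have [|f2oo] := leP +oo (\int[m]_(x in D) (f x ^+ 2)%:E).
  by rewrite leye_eq => /eqP ->; rewrite leey.
have if2 : m.-integrable D (EFin \o (fun x => f x ^+ 2)%R).
  apply/integrableP; split => //.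
  by under eq_integral do rewrite /= ger0_norm ?sqr_ge0//.
have mDoo : m D < +oo by rewrite (le_lt_trans mD1)// ltry.
have ic (k : R) : m.-integrable D (EFin \o cst k).
  apply/integrableP; split; first by apply/measurable_EFinP; exact: measurable_cst.
  by have /= -> := integral_cst m mD `|k|%:E; exact: lte_mul_pinfty.
have if1 : m.-integrable D (EFin \o f).
  (* [`|f| <= 1 + f^2] *)
  apply: (le_integrable mD _ _ (integrableD mD (ic 1%R) if2)).
    exact/measurable_EFinP.
  move=> x Dx /=; rewrite lee_fin.
  rewrite [leRHS]ger0_norm ?addr_ge0 ?sqr_ge0//.
  by case: (ger0P (f x)) => ?; nra.
set a := Rintegral m D f.
have ia : m.-integrable D (EFin \o (fun x => 2 * a * f x)%R).
  by have := integrableZl mD (2 * a)%R if1.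
have : (\int[m]_(x in D) (2 * a * f x - cst (a ^+ 2) x)
    <= \int[m]_(x in D) (f x ^+ 2))%R.
  apply: le_Rintegral => //.
    by have := integrableB mD ia (ic (a ^+ 2)%R).
  by move=> x _; rewrite -subr_ge0; have := sqr_ge0 (f x - a)%R; rewrite /cst; nra.
rewrite RintegralB// RintegralZl// -/a Rintegral_cst//.
have -> : \int[m]_(x in D) (f x ^+ 2)%:E =
    (\int[m]_(x in D) (f x ^+ 2))%R%:E.
  by rewrite /Rintegral fineK//; exact: integrable_fin_num.
rewrite lee_fin => h; apply: le_trans h.
have m1 : (fine (m D) <= 1)%R.
  by rewrite -lee_fin fineK// ge0_fin_numE.
nra.
Qed.

End restriction.

(** * The L^2 norm *)

Section L2.
Context d (T : measurableType d) (R : realType).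
Variables (m : {measure set T -> \bar R}).
Local Open Scope ereal_scope.

Lemma Lnorm2E (f : T -> R) :
  'N[m]_2%:E[EFin \o f] = (\int[m]_x (f x ^+ 2)%:E) `^ 2^-1.
Proof.
rewrite unlock; congr (_ `^ _); apply: eq_integral => x _ /=.
by rewrite powR_mulrn// real_normK// num_real.
Qed.

Lemma Lnorm2_le (f g : T -> R) :
  \int[m]_x (f x ^+ 2)%:E <= \int[m]_x (g x ^+ 2)%:E ->
  'N[m]_2%:E[EFin \o f] <= 'N[m]_2%:E[EFin \o g].
Proof.
move=> fg; rewrite !Lnorm2E; apply: gt0_ler_poweR => //.
- by rewrite in_itv/= leey andbT integral_ge0// => x _; rewrite lee_fin sqr_ge0.
- by rewrite in_itv/= leey andbT integral_ge0// => x _; rewrite lee_fin sqr_ge0.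
Qed.

Lemma Lfun_measurable p (f : T -> R) : f \in Lfun m p -> measurable_fun setT f.
Proof. by move=> /sub_Lfun_mfun; rewrite inE. Qed.

Lemma Lfun_Lnorm_le p (f g : T -> R) : measurable_fun setT f ->
  'N[m]_p[EFin \o f] <= 'N[m]_p[EFin \o g] -> g \in Lfun m p -> f \in Lfun m p.
Proof.
move=> mf fg /sub_Lfun_finLfun; rewrite inE /= => gp.
apply/andP; split; rewrite inE//=; exact: le_lt_trans fg gp.
Qed.

End L2.

(** * Uniqueness of the adjoint *)

Section adjoint.
Context (R : realType) d (X : measurableType d) (mu : probability X R).

(** The difference [h = B f - C f] is orthogonal to all of L^2, as both [B f]
    and [C f] represent [g |-> <A g, f>]; testing against [h] itself gives
    [int h^2 = 0]. *)
Lemma is_L2_adjoint_unique (A B C : (X -> R) -> X -> R) (f : X -> R) :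
  is_L2_adjoint mu A B -> is_L2_adjoint mu A C -> f \in Lfun mu 2%:E ->
  {ae mu, forall x, B f x = C f x}.
Proof.
move=> [_ [LB _ _] AB] [_ [LC _ _] AC] Lf.
pose h := B f \- C f.
have Lh : h \in Lfun mu 2%:E.
  have L21 : (1 <= 2%:E :> \bar R)%E by rewrite lee1n.
  have [_ LZD] := Lfun_submod_closed mu L21.
  suff -> : h = -1 *: C f + B f by exact: (LZD _ _ _ (LC _ Lf) (LB _ Lf)).
  by rewrite scaleN1r addrC.
have h0 : \int[mu]_x (h x * h x) = 0.
  transitivity (L2dot mu h (B f) - L2dot mu h (C f)); last first.
    by rewrite -AB// AC// subrr.
  rewrite /L2dot -RintegralB//.
  - by apply: eq_Rintegral => x _; rewrite -mulrBr.
  - exact/Lfun1_integrable/Lfun2_mul_Lfun1/LB.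
  - exact/Lfun1_integrable/Lfun2_mul_Lfun1/LC.
have ih : mu.-integrable setT (EFin \o (h \* h)).
  exact/Lfun1_integrable/Lfun2_mul_Lfun1.
have /ae_eq_integral_abs : (\int[mu]_x `|(h x * h x)%R%:E| = 0)%E.
  rewrite -[RHS]/(0%:E) -h0 /Rintegral fineK; last exact: integrable_fin_num.
  by apply: eq_integral => x _ /=; rewrite ger0_norm// -expr2 sqr_ge0.
move=> /(_ measurableT (measurable_int _ ih)).
apply: filterS => x /(_ Logic.I) /= [] /eqP.
by rewrite mulf_eq0 orbb subr_eq0 => /eqP.
Qed.

End adjoint.

(** * The composition operator and the conditional expectation *)

Section conditional.
Context (R : realType) (d : measure_display) (X : measurableType d).
Variables (mu : probability X R) (sigma : X -> X) (nu : X -> probability X R).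
Hypothesis msigma : measurable_fun setT sigma.
Hypothesis hinv : invariant_measure mu sigma.
Hypothesis mfiber : forall x, measurable (fiber sigma x).
Hypothesis hnu : conditional_measures mu sigma nu.
Local Open Scope ereal_scope.

Lemma ge0_integral_invariant (f : X -> \bar R) :
  measurable_fun setT f -> (forall x, 0 <= f x) ->
  \int[mu]_x f (sigma x) = \int[mu]_x f x.
Proof.
move=> mf f0.
rewrite -[LHS](@ge0_integral_pushforward _ _ _ _ _ _ msigma mu setT)//.
apply: eq_measure_integral => A mA _; exact: hinv.
Qed.

Lemma Lnorm2_composition (f : X -> R) : measurable_fun setT f ->
  'N[mu]_2%:E[EFin \o composition_op sigma f] = 'N[mu]_2%:E[EFin \o f].
Proof.
move=> mf; rewrite !Lnorm2E; congr (_ `^ _).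
apply: (@ge0_integral_invariant (fun x => (f x ^+ 2)%:E)).
  by apply/measurable_EFinP; exact: measurable_funX.
by move=> x; rewrite lee_fin sqr_ge0.
Qed.

(** For nonnegative [f] the fiber integral is the integral of [f] against the
    kernel [x |-> nu x (_ `&` fiber x)]; the general case is the difference of
    the positive and negative parts. *)
Lemma measurable_fiber_integral (f : X -> \bar R) : measurable_fun setT f ->
  measurable_fun setT (fun x => \int[nu x]_(y in fiber sigma x) f y).
Proof.
have ge0 (g : X -> \bar R) : measurable_fun setT g -> (forall x, 0 <= g x) ->
  measurable_fun setT (fun x => \int[nu x]_(y in fiber sigma x) g y).
  move=> mg g0; under eq_fun do rewrite -(ge0_integral_mrestr _ (mfiber _) mg g0).
  apply: (@measurable_fun_integral_kernel _ _ X X R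
    (fun x => mrestr (nu x) (mfiber x))) => // B mB.
  by have [_ + _] := hnu; exact.
move=> mf; under eq_fun do rewrite integralE.
by apply: emeasurable_funB; apply: ge0 => //;
  [exact: measurable_funepos|exact: measurable_funeneg].
Qed.

(** Disintegrating [`|f|] gives a fiber integral that is itself integrable in
    [x], hence finite almost everywhere. *)
Lemma ae_fiber_integrable (f : X -> R) : f \in Lfun mu 1 ->
  {ae mu, forall x, (nu x).-integrable (fiber sigma x) (EFin \o f)}.
Proof.
move=> Lf; have mf := Lfun_measurable Lf.
have Lnf := Lfun_norm Lf; have mnf := Lfun_measurable Lnf.
have [_ _ /(_ _ Lnf) nuf] := hnu.
pose F x := \int[nu x]_(y in fiber sigma x) `|f y|%:E.
have F0 x : 0 <= F x by apply: integral_ge0 => y _; rewrite lee_fin.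
have iF : mu.-integrable setT F.
  apply/integrableP; split.
    by apply: measurable_fiber_integral; exact/measurable_EFinP.
  under eq_integral do rewrite gee0_abs//.
  rewrite -nuf; move/Lfun1_integrable/integrableP : Lf => [_].
  by under eq_integral do rewrite /=.
apply: filterS (integrable_ae measurableT iF) => x /(_ Logic.I) Fx.
apply/integrableP; split; first exact/measurable_EFinP/measurable_funTS.
by move: Fx; rewrite ge0_fin_numE.
Qed.

Lemma measurable_conditional (f : X -> R) : measurable_fun setT f ->
  measurable_fun setT (conditional_op sigma nu f).
Proof.
move=> mf; apply: (@measurableT_comp _ _ _ _ _ _ fine) => //.
by apply: measurable_fiber_integral; exact/measurable_EFinP.
Qed.

Lemma Lnorm2_conditional (f : X -> R) : f \in Lfun mu 2%:E ->
  'N[mu]_2%:E[EFin \o conditional_op sigma nu f] <= 'N[mu]_2%:E[EFin \o f].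
Proof.
move=> Lf; have mf := Lfun_measurable Lf.
have mf2 : measurable_fun setT (fun x => f x ^+ 2)%R by exact: measurable_funX.
have [_ _ nuE] := hnu.
apply: Lnorm2_le; rewrite (nuE (fun x => f x ^+ 2)%R); last first.
  exact/Lfun1_integrable/Lfun2_integrable_sqr.
apply: ge0_le_integral => //.
- by move=> x _; rewrite lee_fin sqr_ge0.
- by apply/measurable_EFinP/measurable_funX; exact: measurable_conditional.
- by apply: measurable_fiber_integral; exact/measurable_EFinP.
- move=> x _; apply: sqr_Rintegral_le => //; exact: probability_le1.
Qed.

Lemma bounded_composition : bounded_L2_operator mu (composition_op sigma).
Proof.
split.
- move=> f Lf; have mf := Lfun_measurable Lf.
  apply: (Lfun_Lnorm_le _ _ Lf); first exact: measurableT_comp.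
  by rewrite Lnorm2_composition.
- by move=> a f g _ _; apply: nearW.
- exists 1%R => f Lf; rewrite mul1e Lnorm2_composition//.
  exact: Lfun_measurable Lf.
Qed.

Lemma Lfun2_Lfun1 (f : X -> R) : f \in Lfun mu 2%:E -> f \in Lfun mu 1.
Proof. by apply: Lfun_subset12; rewrite fin_num_measure. Qed.

Lemma bounded_conditional : bounded_L2_operator mu (conditional_op sigma nu).
Proof.
split.
- move=> f Lf; apply: (Lfun_Lnorm_le _ _ Lf); last exact: Lnorm2_conditional.
  exact/measurable_conditional/Lfun_measurable/Lf.
- move=> a f g /Lfun2_Lfun1 /ae_fiber_integrable If /Lfun2_Lfun1 /ae_fiber_integrable Ig.
  apply: filterS2 If Ig => x If Ig.
  rewrite /conditional_op RintegralD//; first by rewrite RintegralZl.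
  by have := integrableZl (mfiber x) a If.
- by exists 1%R => f Lf; rewrite mul1e Lnorm2_conditional.
Qed.

(** On the fiber of [x], [f \o sigma] is the constant [f x] and comes out of the
    inner integral; this requires [g] to be integrable on the fiber, hence the
    passage through almost every [x]. *)
Lemma L2dot_composition (f g : X -> R) :
  f \in Lfun mu 2%:E -> g \in Lfun mu 2%:E ->
  L2dot mu (composition_op sigma f) g = L2dot mu f (conditional_op sigma nu g).
Proof.
move=> Lf Lg; have mf := Lfun_measurable Lf; have mg := Lfun_measurable Lg.
have [LS _ _] := bounded_composition.
have Lfg := Lfun2_mul_Lfun1 (LS _ Lf) Lg.
have [_ _ nuE] := hnu.
rewrite /L2dot /Rintegral nuE//; congr fine.
apply: ae_eq_integral => //.
- by apply/measurable_fiber_integral/measurable_EFinP; exact: Lfun_measurable Lfg.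
- apply/measurable_EFinP/measurable_funM => //; exact: measurable_conditional.
- apply: filterS (ae_fiber_integrable (Lfun2_Lfun1 Lg)) => x Ig _.
  under eq_integral => y.
    rewrite inE /fiber /= => yx; rewrite /composition_op /= yx EFinM; over.
  rewrite integralZl// EFinM; congr (_ * _).
  by rewrite /conditional_op /Rintegral fineK//; exact: integrable_fin_num.
Qed.

End conditional.
(** * The adjoint of the composition operator *)

Unset Implicit Arguments.
Theorem theorem3p9 (R : realType) (d : measure_display) (X : measurableType d)
    (mu : probability X R) (sigma : X -> X) (nu : X -> probability X R)
    (hX : standard_borel R X)
    (hmu : nonatomic mu)
    (hsigma : surjective_endomorphism sigma)
    (hinv : invariant_measure mu sigma)
    (hnu : conditional_measures mu sigma nu) :
  is_L2_adjoint mu (composition_op sigma) (conditional_op sigma nu) /\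
  (forall S_adj : (X -> R) -> X -> R,
     is_L2_adjoint mu (composition_op sigma) S_adj ->
     forall f : X -> R, f \in Lfun mu 2%:E ->
       {ae mu, forall x, conditional_op sigma nu f x = S_adj f x}).
Proof.
have [msigma _] := hsigma.
have mfiber x := measurable_fiber x hX msigma.
have adj : is_L2_adjoint mu (composition_op sigma) (conditional_op sigma nu).
  split; [exact: bounded_composition|exact: bounded_conditional|].
  by move=> f g; exact: L2dot_composition.
split; first exact: adj.
by move=> S_adj adjS f Lf; exact: (is_L2_adjoint_unique adj adjS Lf).
Qed.
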